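(* Let $a>1$ be an integer. Then $$[1;\overline{a^{2k-1}-1,a^{2k}+1}]_{k=1}^{\infty}=\frac{(-1/a;-1/a^{3})_{\infty}}{(1/a^{2};-1/a^{3})_{\infty}}$$ and $$[1;\overline{a^{k}-1,1}]_{k=1}^{\infty}=\frac{(1/a^{2};1/a^{3})_{\infty}}{(1/a;1/a^{3})_{\infty}}.$$
   Context: $[a_0;a_1,a_2,\ldots]$ denotes the (value of the) infinite regular continued fraction $a_0+\cfrac{1}{a_1+\cfrac{1}{a_2+\cdots}}$. The notation $[a_0;\overline{f_1(k),\ldots,f_r(k)}\,]_{k=1}^{\infty}$ means that after $a_0$ the partial quotients are $f_1(1),\ldots,f_r(1),f_1(2),\ldots,f_r(2),f_1(3),\ldots$, i.e. the blocks $f_1(k),\ldots,f_r(k)$ for $k=1,2,3,\ldots$ concatenated in order. For complex $x,q$ with $|q|<1$: $(x;q)_\infty:=\prod_{j=0}^{\infty}(1-xq^{j})$. *)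

(* Defs.v *)
From HB Require Import structures.
From mathcomp Require Import all_boot all_order all_algebra.
From mathcomp Require Import all_classical all_reals all_analysis.
Set Implicit Arguments.
Unset Strict Implicit.
Unset Printing Implicit Defensive.
Import Order.TTheory GRing.Theory Num.Theory.
Import numFieldNormedType.Exports.
Local Open Scope classical_set_scope.
Local Open Scope ring_scope.

(* The n-th convergent [b 0; b 1, ..., b n]. *)
Fixpoint cf_convergent (R : realType) (b : nat -> int) (n : nat) : R :=
  if n is m.+1 then
    (b 0%N)%:~R + (cf_convergent R (fun i => b i.+1) m)^-1
  else (b 0%N)%:~R.

(* [b 0; b 1, b 2, ...] is a regular continued fraction (its partial quotients
   after b 0 are positive, so no convergent divides by zero) and its value, the
   limit of the convergents, is v. *)
Definition is_regular_cf_value (R : realType) (b : nat -> int) (v : R) : Prop :=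
  (forall n : nat, 0 < b n.+1) /\ cf_convergent R b @ \oo --> v.

(* The sequence a0, f_1 1, ..., f_r 1, f_1 2, ..., f_r 2, ... for
   fs = [:: f_1; ...; f_r]; blocks are numbered from k = 1. *)
Definition cf_blocks (a0 : int) (fs : seq (nat -> int)) (n : nat) : int :=
  if n is m.+1 then
    nth (fun=> 0) fs (m %% size fs) (m %/ size fs).+1
  else a0.

(* (x; q)_oo; the product converges when `|q| < 1 (K may be real or complex). *)
Definition qpoch (K : numFieldType) (x q : K) : K :=
  limn (fun n : nat => \prod_(0 <= j < n) (1 - x * q ^+ j)).

(* Main.v *)
Require Import Defs.
From HB Require Import structures.
From mathcomp Require Import all_boot all_order all_algebra.
From mathcomp Require Import all_classical all_reals all_analysis.
From mathcomp Require Import ring lra zify.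
Import Order.TTheory GRing.Theory Num.Theory.
Import numFieldNormedType.Exports.
Local Open Scope classical_set_scope.
Local Open Scope ring_scope.

(** Both continued fractions are one continued fraction of Ramanujan,

      (q; q^3)_oo / (q^2; q^3)_oo = 1 - q/(1+q - q^3/(1+q^2 - q^5/(1+q^3 - ...))),

    read at q = -1/a, and inverted at q = 1/a.  Clearing the powers of a turns
    the level 1 + q^n into a^n + (a q)^n.  For a q = -1 the minus signs disappear
    as well, which gives the first fraction; for a q = 1 they remain, and the
    partial quotients 1 of the second fraction are what makes it regular.

    The numerators and denominators of Ramanujan's fraction solve
    X(n+2) = (1 + q^(n+1)) X(n+1) - q^(2n+1) X(n).  The point of the proof is
    that this recurrence, a q-analogue of the Airy equation, has closed form
    solutions that advance three steps at a time, like the two power series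
    solutions of y'' = x y:

      S_r(n) = sum_k c_k [n choose 3k+r]_q   (r = 0, 1),
      c_(k+1) = q^(2m+2) (1 - q^(m+1)) c_k   with m = 3k + r

    (cubic_sum).  Substituted in the recurrence, the k-th summand becomes a
    difference c_k X_m - c_(k+1) X_(m+3) (qbinom_cubic_telescope), whence
    cubic_sum_rec.  The initial values S_0 = 1, 1 and S_1 = 0, 1 are those of
    the numerators and of the denominators.

    As n grows, [n choose m]_q tends to 1/(q; q)_m, and S_r(n) to the sum of
    c_k / (q; q)_(3k+r).  Cancelling the factors 1 - q^(m+1), this is, up to
    1/(q; q)_r, Cauchy's series

      sum_k Q^(k(k-1)) z^k / ((Q; Q)_k (z; Q)_k) = 1/(z; Q)_oo

    in base Q = q^3 with z = q^(2+2r) (cubic_coef_cauchy), so that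
    S_0 -> 1/(q^2; q^3)_oo and S_1 -> 1/(q; q^3)_oo.  The limit is not computed
    from the infinite series: Cauchy's identity has a finite form
    (finite_cauchy), and S_r(n) minus that finite sum tends to 0 term by term
    under a geometric bound (tannery0, cubic_sum_cvg).

    It remains to identify the convergents with quotients of the S_r
    (cf_convergentE).  In the second fraction this concerns the convergents of
    even index; those of odd index are quotients of differences of two
    consecutive scaled sums and have the same limit. *)

(** * Finite q-products and Gaussian binomials *)

Definition pochn {R : pzRingType} (x q : R) (n : nat) : R :=
  \prod_(0 <= j < n) (1 - x * q ^+ j).

Lemma pochn0 {R : pzRingType} (x q : R) : pochn x q 0 = 1.
Proof. by rewrite /pochn big_nil. Qed.

Lemma pochnS {R : pzRingType} (x q : R) n :
  pochn x q n.+1 = pochn x q n * (1 - x * q ^+ n).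
Proof. by rewrite /pochn big_nat_recr. Qed.

Lemma pochnSl {R : pzRingType} (x q : R) n :
  pochn x q n.+1 = (1 - x) * pochn (x * q) q n.
Proof.
rewrite /pochn big_nat_recl//= expr0 mulr1; congr (_ * _).
by apply: eq_bigr => i _; rewrite exprS mulrA.
Qed.

Lemma pochn_neq0 {F : fieldType} (x q : F) n :
  (forall j, x * q ^+ j != 1) -> pochn x q n != 0.
Proof.
move=> xq; elim: n => [|n IHn]; first by rewrite pochn0 oner_neq0.
by rewrite pochnS mulf_neq0// subr_eq0 eq_sym.
Qed.

(** The Pascal recursion makes this a polynomial in q, defined for every q and
    zero as soon as m > n, so that sums over m can be extended freely. *)
Fixpoint qbinom {R : pzRingType} (q : R) (n m : nat) : R :=
  match n, m with
  | _, 0 => 1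
  | 0, _.+1 => 0
  | n'.+1, m'.+1 => qbinom q n' m' + q ^+ m'.+1 * qbinom q n' m'.+1
  end.

Lemma qbinom0 {R : pzRingType} (q : R) n : qbinom q n 0 = 1.
Proof. by case: n. Qed.

Lemma qbinomS {R : pzRingType} (q : R) n m :
  qbinom q n.+1 m.+1 = qbinom q n m + q ^+ m.+1 * qbinom q n m.+1.
Proof. by []. Qed.

Arguments qbinom : simpl never.

Lemma qbinom_small {R : pzRingType} (q : R) n m :
  (n < m)%N -> qbinom q n m = 0.
Proof.
elim: n m => [|n IHn] [|m]// nm.
by rewrite qbinomS !IHn ?mulr0 ?addr0// ltnW.
Qed.

(** The absorption identity (1 - q^(m+1)) [n, m+1] = (1 - q^(n-m)) [n, m],
    multiplied by q^m so that it also makes sense, and holds, for m > n. *)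
Lemma qbinom_absorb {R : comPzRingType} (q : R) n m :
  q ^+ m * (1 - q ^+ m.+1) * qbinom q n m.+1
  = (q ^+ m - q ^+ n) * qbinom q n m.
Proof.
elim: n m => [|n IHn] [|m].
- by rewrite [qbinom q 0 1]qbinom_small// !expr0 subrr mulr0 mul0r.
- by rewrite !qbinom_small// !mulr0.
- have := IHn 0%N; rewrite qbinomS !qbinom0 !exprS !expr0 => e.
  by rewrite mulrDr mulrCA e; ring.
- rewrite !qbinomS mulrDr mulrCA IHn; have := IHn m; rewrite !exprS => e.
  rewrite [RHS]mulrDr -mulrBr -[q * _ * qbinom _ _ _]mulrA -e; ring.
Qed.

Lemma qbinom_absorb_div {F : fieldType} (q : F) n m : q != 0 ->
  (1 - q ^+ m.+1) * qbinom q n m.+1 = (1 - q ^+ n / q ^+ m) * qbinom q n m.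
Proof.
move=> q0; have qm0 : q ^+ m != 0 by rewrite expf_neq0.
apply: (mulfI qm0); rewrite mulrA qbinom_absorb mulrA; congr (_ * _).
by rewrite mulrBr mulr1 mulrC divfK.
Qed.

(** The other Pascal rule, read off from the first one and absorption. *)
Lemma qbinomS_dual {F : fieldType} (q : F) n m : q != 0 ->
  qbinom q n.+1 m.+1 = qbinom q n m.+1 + q ^+ n / q ^+ m * qbinom q n m.
Proof.
move=> q0; have := qbinom_absorb_div q n m q0; rewrite qbinomS !mulrBl !mul1r => /eqP.
by rewrite subr_eq => /eqP {2}->; ring.
Qed.

Lemma pochn_qbinom {F : fieldType} (q : F) m d : q != 0 ->
  pochn q q m * pochn q q d * qbinom q (m + d) m = pochn q q (m + d).
Proof.
move=> q0; elim: m d => [|m IHm] d.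
  by rewrite pochn0 qbinom0 add0n mul1r mulr1.
have := IHm d.+1; rewrite addnS -addSn => <-.
have := qbinom_absorb_div q (m + d.+1) m q0.
rewrite exprD [q ^+ m * _]mulrC mulfK ?expf_neq0// addnS -addSn => e.
rewrite !pochnS -!exprS.
transitivity (pochn q q m * pochn q q d * ((1 - q ^+ m.+1) * qbinom q (m.+1 + d) m.+1)).
  by ring.
by rewrite e; ring.
Qed.

(** Pascal's rule splits the sum for n+1 in two; after a shift of the index,
    the k-th terms combine over the common denominator (z; q)_(k+1), and the
    factor 1 - z q^k + z q^k = 1 leaves the sum for n with z replaced by z q. *)
Lemma finite_cauchy {F : fieldType} (q z : F) n : (forall j, z * q ^+ j != 1) ->
  \sum_(0 <= k < n.+1) qbinom q n k * (q ^+ (k * k.-1) * z ^+ k / pochn z q k)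
  = (pochn z q n)^-1.
Proof.
elim: n z => [|n IHn] z zq.
  by rewrite big_nat1 !pochn0 qbinom0 mul0n !expr0 !invr1 !mulr1.
rewrite pochnSl invfM -IHn; last by move=> j; rewrite -mulrA -exprS.
rewrite big_nat_recl// [X in _ + X](eq_big_nat _ _ (F2 := fun i =>
   qbinom q n i * (q ^+ (i.+1 * i) * z ^+ i.+1 / pochn z q i.+1)
   + qbinom q n i.+1 * (q ^+ (i.+1 * i.+1) * z ^+ i.+1 / pochn z q i.+1))); last first.
  move=> i _; by rewrite qbinomS [in RHS]mulnS exprD/=; ring.
rewrite big_split/= addrCA.
pose f k := qbinom q n k * (q ^+ (k * k) * z ^+ k / pochn z q k).
have -> : qbinom q n.+1 0 * (q ^+ (0 * 0.-1) * z ^+ 0 / pochn z q 0) = f 0%N.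
  by rewrite /f !qbinom0 !muln0.
rewrite -[X in _ + (_ + X)]/(\sum_(0 <= i < n.+1) f i.+1).
rewrite -(big_nat_recl n.+1 0 f)// (big_nat_recr n.+1 0 f)//=.
rewrite {2}/f qbinom_small// mul0r addr0.
rewrite -big_split/= mulr_sumr; apply: eq_bigr => k _; rewrite /f.
have z1 : 1 - z != 0 by rewrite subr_eq0 eq_sym; have := zq 0%N; rewrite mulr1.
have zk : 1 - z * q ^+ k != 0 by rewrite subr_eq0 eq_sym.
have pz : pochn z q k != 0 by apply: pochn_neq0.
have -> : pochn (z * q) q k = pochn z q k * (1 - z * q ^+ k) / (1 - z).
  by rewrite -pochnS pochnSl [RHS]mulrC mulKf.
rewrite mulSn (_ : k * k = k + k * k.-1)%N; last first.
  by case: (k) => //= j; rewrite -mulnS.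
rewrite exprMn exprS pochnS !exprD; field.
by rewrite zk pz z1.
Qed.

(** * Cubic solutions of the recurrence *)

Definition cubic_coef {R : pzRingType} (q : R) (r k : nat) : R :=
  \prod_(0 <= j < k) (q ^+ (2 * (3 * j + r) + 2) * (1 - q ^+ (3 * j + r).+1)).

Definition cubic_sum {R : pzRingType} (q : R) (r n : nat) : R :=
  \sum_(0 <= k < n.+1) cubic_coef q r k * qbinom q n (3 * k + r).

Lemma cubic_coefS {R : pzRingType} (q : R) r k :
  cubic_coef q r k.+1
  = cubic_coef q r k * (q ^+ (2 * (3 * k + r) + 2) * (1 - q ^+ (3 * k + r).+1)).
Proof. by rewrite /cubic_coef big_nat_recr. Qed.

(** A common range of summation for the three values of n that occur in the
    recurrence. *)
Lemma cubic_sum_widen {R : pzRingType} (q : R) r n K : (n < K)%N ->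
  cubic_sum q r n = \sum_(0 <= k < K) cubic_coef q r k * qbinom q n (3 * k + r).
Proof.
move=> nK; rewrite (big_cat_nat _ nK)//= -[LHS]addr0; congr (_ + _).
rewrite big_nat big1// => k /andP[nk _]; rewrite qbinom_small ?mulr0//; lia.
Qed.

(** The antidifference X_m of the telescoping: X_m = q^(n-m+2) [n, m-2], with
    value 0 at m = 0 and m = 1, where the two families of sums start. *)
Definition cubic_flux {F : fieldType} (q : F) (n m : nat) : F :=
  if m is m'.+2 then q ^+ n / q ^+ m' * qbinom q n m' else 0.

(** The coefficient in front of X_(m+3) is the ratio of consecutive cubic
    coefficients, which is where these coefficients come from.  By absorption
    X_(m+3) becomes a multiple of [n, m], and the two Pascal rules do the rest. *)
Lemma qbinom_cubic_telescope {F : fieldType} (q : F) n m : q != 0 ->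
  qbinom q n.+2 m - (1 + q ^+ n.+1) * qbinom q n.+1 m
    + q ^+ (2 * n).+1 * qbinom q n m
  = cubic_flux q n m
    - q ^+ (2 * m + 2) * (1 - q ^+ m.+1) * cubic_flux q n (m + 3).
Proof.
move=> q0; have qX j : q ^+ j != 0 by rewrite expf_neq0.
rewrite (_ : cubic_flux q n (m + 3) = q ^+ n / q ^+ m.+1 * qbinom q n m.+1); last first.
  by rewrite addn3.
rewrite -[q ^+ (2 * m + 2) * _ * _]mulrA [(1 - _) * (_ * _)]mulrCA.
rewrite qbinom_absorb_div// (_ : q ^+ (2 * n).+1 = q * (q ^+ n * q ^+ n)); last first.
  by rewrite exprS mul2n -addnn exprD.
rewrite (_ : q ^+ (2 * m + 2) = q ^+ m * q ^+ m * (q * q)); last first.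
  by rewrite mul2n -addnn !exprD.
case: m => [|[|m]]; rewrite /cubic_flux.
- by rewrite !qbinom0 !exprS; field; rewrite ?oner_neq0 ?q0.
- rewrite (qbinomS_dual q n.+1 0)// (qbinomS q n 0) !qbinom0 !exprS.
  by field; rewrite ?oner_neq0 ?q0.
- rewrite (qbinomS_dual q n.+1)// !qbinomS; rewrite !exprS; field.
  by rewrite q0 qX.
Qed.

(** By qbinom_cubic_telescope the sum telescopes; its lower end vanishes for
    r <= 1 and its upper end is a Gaussian binomial with m > n. *)
Lemma cubic_sum_rec {F : fieldType} (q : F) r n : q != 0 -> (r <= 1)%N ->
  cubic_sum q r n.+2
  = (1 + q ^+ n.+1) * cubic_sum q r n.+1 - q ^+ (2 * n).+1 * cubic_sum q r n.
Proof.
move=> q0 r1.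
rewrite !(@cubic_sum_widen _ q r _ n.+3)//; last by lia.
apply/eqP; rewrite -subr_eq0 opprB addrA.
pose t k := cubic_coef q r k * cubic_flux q n (3 * k + r).
have tel k : t k - t k.+1 = cubic_coef q r k * (qbinom q n.+2 (3 * k + r)
    - (1 + q ^+ n.+1) * qbinom q n.+1 (3 * k + r)
    + q ^+ (2 * n).+1 * qbinom q n (3 * k + r)).
  rewrite qbinom_cubic_telescope// /t cubic_coefS.
  rewrite (_ : 3 * k.+1 + r = 3 * k + r + 3)%N; last by lia.
  by ring.
have -> : \sum_(0 <= k < n.+3) cubic_coef q r k * qbinom q n.+2 (3 * k + r) +
   q ^+ (2 * n).+1 * \sum_(0 <= k < n.+3) cubic_coef q r k * qbinom q n (3 * k + r) -
   (1 + q ^+ n.+1) * \sum_(0 <= k < n.+3) cubic_coef q r k * qbinom q n.+1 (3 * k + r)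
   = \sum_(0 <= k < n.+3) (t k - t k.+1).
  rewrite !mulr_sumr -big_split/= -sumrB; apply: eq_bigr => k _.
  by rewrite tel; ring.
rewrite (telescope_sumr_eq (fun k => - t k))//; last first.
  by move=> k _; rewrite opprK addrC.
have -> : t 0%N = 0.
  by rewrite /t muln0 add0n; case: (r) r1 => [|[|]]//= _; rewrite mulr0.
rewrite /t (_ : 3 * n.+3 + r = (3 * n + 7 + r).+2)%N; last by lia.
by rewrite /cubic_flux qbinom_small ?mulr0 ?mulr0 ?oppr0 ?oppr0 ?addr0 ?eqxx //; lia.
Qed.

Lemma cubic_sum_at0 {R : pzRingType} (q : R) r : cubic_sum q r 0 = (r == 0)%:R.
Proof.
by rewrite /cubic_sum big_nat1 /cubic_coef big_nil mul1r muln0; case: r.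
Qed.

Lemma cubic_sum_at1 {R : pzRingType} (q : R) r : (r <= 1)%N -> cubic_sum q r 1 = 1.
Proof.
move=> r1; rewrite (@cubic_sum_widen _ q r 1 2)// big_nat_recl// big_nat1.
rewrite [qbinom q 1 (3 * 1 + r)]qbinom_small ?mulr0 ?addr0; last by lia.
rewrite /cubic_coef big_nil mul1r muln0.
case: r r1 => [|[|]]// _; rewrite add0n ?qbinom0//.
by rewrite qbinomS qbinom0 qbinom_small// mulr0 addr0.
Qed.

(** * Tannery's theorem and infinite q-products *)

Lemma cvg_norm_bounded {R : realType} (u : nat -> R) (l : R) :
  u @ \oo --> l -> exists2 B, 0 < B & forall n, `|u n| <= B.
Proof.
move=> ul; have /cvg_seq_bounded : cvgn u by apply/cvg_ex; exists l.
by move=> /pinfty_ex_gt0[B B0 uB]; exists B => // n; apply: uB.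
Qed.

Lemma geometric_sum_le {R : realType} (y r : R) n : 0 <= y -> 0 <= r < 1 ->
  \sum_(0 <= j < n) y * r ^+ j <= y / (1 - r).
Proof.
move=> y0 /andP[r0 r1]; have r1' : 0 < 1 - r by rewrite subr_gt0.
have -> : \sum_(0 <= j < n) y * r ^+ j = y / (1 - r) * (1 - r ^+ n).
  elim: n => [|n IHn]; first by rewrite big_geq// expr0 subrr mulr0.
  by rewrite big_nat_recr//= IHn exprS; field; rewrite gt_eqF.
rewrite ler_piMr ?divr_ge0 ?(ltW r1')//.
by rewrite lerBlDr lerDl exprn_ge0.
Qed.

(** Dominated convergence for series, in the special case of limit 0: split at
    an index after which the geometric bound leaves less than e/2. *)
Lemma tannery0 {R : realType} (u : nat -> nat -> R) (C r : R) :
  0 <= r < 1 -> (forall n k, `|u n k| <= C * r ^+ k) ->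
  (forall k, u ^~ k @ \oo --> 0) ->
  (fun n => \sum_(0 <= k < n.+1) u n k) @ \oo --> 0.
Proof.
move=> /andP[r0 r1] uC u0.
have C0 : 0 <= C by have := uC 0%N 0%N; rewrite expr0 mulr1; apply: le_trans.
have r1' : 0 < 1 - r by rewrite subr_gt0.
apply/cvgrPdist_lt => e e0.
(* The tail of the dominating series from K on is C r^K / (1 - r). *)
have [K _ rK] : \forall K \near \oo, C / (1 - r) * r ^+ K < e / 2.
  have /(_ (C / (1 - r))) := cvg_geometric _ (z := r); rewrite ger0_norm// => /(_ r1).
  move=> /cvgrPdist_lt/(_ (e / 2)); rewrite divr_gt0// => /(_ isT).
  apply: filterS => K; rewrite /geometric/= sub0r normrN; apply: le_lt_trans.
  exact: ler_norm.
have {}rK := rK K (leqnn K).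
have head : (fun n => \sum_(0 <= k < K) `|u n k|) @ \oo --> (\sum_(0 <= k < K) (0 : R)).
  apply: cvg_big => [|k _]; first exact: add_continuous.
  by rewrite -(normr0 R); apply: cvg_norm.
rewrite big1 // in head.
move/cvgrPdist_lt : head => /(_ (e / 2)); rewrite divr_gt0// => /(_ isT) head.
near=> n.
rewrite sub0r normrN (@big_cat_nat _ _ _ K)//=; last by near: n; exists K => // n /= /leqW.
rewrite (splitr e); apply: le_lt_trans (ler_normD _ _) _; apply: ltrD.
  apply: le_lt_trans (ler_norm_sum _ _ _) _.
  have : `|0 - \sum_(0 <= k < K) `|u n k| | < e / 2 by near: n.
  by rewrite sub0r normrN; apply: le_lt_trans; apply: ler_norm.
apply: le_lt_trans rK; apply: le_trans (ler_norm_sum _ _ _) _.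
rewrite -{1}(add0n K) big_addn mulrAC.
have CK : 0 <= C * r ^+ K by rewrite mulr_ge0 ?exprn_ge0.
apply: le_trans (geometric_sum_le (C * r ^+ K) r (n.+1 - K) CK _); last by rewrite r0.
by apply: ler_sum => k _; apply: le_trans (uC _ _) _; rewrite addnC exprD mulrA.
Unshelve. all: by end_near. Qed.

Lemma pochnD {R : pzRingType} (x q : R) m n :
  pochn x q (m + n) = pochn x q m * pochn (x * q ^+ m) q n.
Proof.
elim: n => [|n IHn]; first by rewrite addn0 pochn0 mulr1.
by rewrite addnS !pochnS IHn exprD !mulrA.
Qed.

Lemma mulrX_neq1 {R : realType} (x q : R) j :
  `|x| < 1 -> `|q| < 1 -> x * q ^+ j != 1.
Proof.
move=> x1 q1; apply/eqP => e.
have : `|x * q ^+ j| < 1.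
  rewrite normrM normrX; apply: le_lt_trans x1.
  by rewrite ler_piMr// exprn_ile1// ltW.
by rewrite e normr1 ltxx.
Qed.

Lemma pochn_norm_le {R : realType} (x q : R) n : `|q| < 1 ->
  `|pochn x q n| <= expR (`|x| / (1 - `|q|)).
Proof.
move=> q1; apply: (@le_trans _ _ (expR (\sum_(0 <= j < n) `|x| * `|q| ^+ j))).
  elim: n => [|n IHn]; first by rewrite pochn0 big_nil expR0 normr1.
  rewrite pochnS normrM big_nat_recr//= expRD ler_pM//.
  apply: le_trans (expR_ge1Dx _); rewrite -normrX -normrM.
  by apply: le_trans (ler_normB _ _) _; rewrite normr1.
by rewrite ler_expR geometric_sum_le// normr_ge0.
Qed.

(** Weierstrass's product inequality: a product of factors 1 - e_j is at least
    1 minus the sum of the e_j. *)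
Lemma pochn_norm_ge {R : realType} (x q : R) n : `|q| < 1 -> `|x| <= 1 ->
  1 - `|x| / (1 - `|q|) <= `|pochn x q n|.
Proof.
move=> q1 x1; apply: (@le_trans _ _ (1 - \sum_(0 <= j < n) `|x| * `|q| ^+ j)).
  by rewrite lerD2l lerN2 geometric_sum_le// normr_ge0.
elim: n => [|n IHn]; first by rewrite pochn0 big_nil subr0 normr1.
rewrite pochnS normrM big_nat_recr//=.
set S := \sum_(_ <= _ < _) _ in IHn *; set e := `|x| * _.
have S0 : 0 <= S by apply: sumr_ge0 => j _; rewrite mulr_ge0// exprn_ge0.
have e0 : 0 <= e by rewrite mulr_ge0// exprn_ge0.
have e1 : e <= 1 by rewrite mulr_ile1 ?exprn_ge0// exprn_ile1// ltW.
have fe : 1 - e <= `|1 - x * q ^+ n|.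
  by rewrite /e -normrX -normrM -[X in X - _](normr1 R) lerB_dist.
apply: (@le_trans _ _ (`|pochn x q n| * (1 - e))); last by rewrite ler_wpM2l.
apply: (@le_trans _ _ ((1 - S) * (1 - e))); last by rewrite ler_wpM2r// subr_ge0.
have := mulr_ge0 S0 e0; lra.
Qed.

(** The differences of consecutive partial products are - x q^n times a bounded
    factor, hence absolutely summable. *)
Lemma pochn_cvg {R : realType} (x q : R) : `|q| < 1 ->
  pochn x q @ \oo --> qpoch x q.
Proof.
move=> q1; suff : cvgn (pochn x q) by [].
pose B := expR (`|x| / (1 - `|q|)).
have : cvgn (series (fun n => - (pochn x q n * (x * q ^+ n)))).
  apply: normed_cvg; apply: (@series_le_cvg _ _ (geometric (B * `|x|) `|q|)).
  - by move=> n; rewrite /= normr_ge0.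
  - by move=> n; rewrite /geometric/= !mulr_ge0// ?exprn_ge0// expR_ge0.
  - move=> n; rewrite /geometric/= normrN !normrM normrX mulrA.
    by rewrite !ler_wpM2r ?exprn_ge0// pochn_norm_le.
  - by apply: is_cvg_geometric_series; rewrite normr_id.
move=> /cvg_ex[l sl]; apply/cvg_ex; exists (l + 1).
rewrite (_ : pochn x q = fun n =>
  series (fun n => - (pochn x q n * (x * q ^+ n))) n + 1); last first.
  apply/funext; elim => [|n IHn]; first by rewrite /series/= big_nil add0r pochn0.
  by rewrite seriesSr addrAC -IHn pochnS; ring.
by apply: cvgD => //; apply: cvg_cst.
Qed.

(** Far enough in the sequence the remaining factors satisfy
    |x q^M| / (1 - |q|) < 1/2, so their product stays above 1/2 in absolute value
    by pochn_norm_ge, and the first M factors do not vanish. *)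
Lemma qpoch_neq0 {R : realType} (x q : R) : `|x| < 1 -> `|q| < 1 ->
  qpoch x q != 0.
Proof.
move=> x1 q1; have q1' : 0 < 1 - `|q| by rewrite subr_gt0.
have [M _ /(_ M (leqnn M))/= xM] : \forall M \near \oo, `|x| / (1 - `|q|) * `|q| ^+ M < 1 / 2.
  have /(_ (`|x| / (1 - `|q|))) := cvg_geometric _ (z := `|q|); rewrite normr_id => /(_ q1).
  move=> /cvgrPdist_lt/(_ (1 / 2)); rewrite divr_gt0// => /(_ isT).
  apply: filterS => K; rewrite /geometric/= sub0r normrN; apply: le_lt_trans.
  exact: ler_norm.
have pM : pochn x q M != 0 by apply: pochn_neq0 => j; apply: mulrX_neq1.
have xM1 : `|x * q ^+ M| <= 1.
  rewrite normrM normrX mulr_ile1 ?exprn_ge0 ?(ltW x1)//.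
  by rewrite exprn_ile1// ltW.
have low n : `|pochn x q M| / 2 <= `|pochn x q (n + M)|.
  rewrite addnC pochnD normrM ler_wpM2l//; apply: le_trans (pochn_norm_ge _ _ _ q1 xM1).
  by rewrite normrM normrX mulrAC; move: xM; lra.
have /cvg_norm := pochn_cvg x q q1; rewrite -(cvg_shiftn M) => h.
rewrite -normr_gt0; apply: (@lt_le_trans _ _ (`|pochn x q M| / 2)).
  by rewrite divr_gt0// normr_gt0.
by apply: (cvgr_to_ge h); apply: nearW => n; apply: low.
Qed.

(** * Limits of the cubic sums *)

Lemma pochn_inv_cvg {R : realType} (x q : R) : `|x| < 1 -> `|q| < 1 ->
  (fun n => (pochn x q n)^-1) @ \oo --> (qpoch x q)^-1.
Proof. by move=> x1 q1; apply: cvgV; [apply: qpoch_neq0|apply: pochn_cvg]. Qed.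

Lemma pochn_qbinom_div {R : realType} (q : R) m d : q != 0 -> `|q| < 1 ->
  pochn q q m * qbinom q (m + d) m = pochn q q (m + d) / pochn q q d.
Proof.
move=> q0 q1; rewrite -pochn_qbinom// mulrAC mulfK//.
by apply: pochn_neq0 => j; apply: mulrX_neq1.
Qed.

Lemma qbinom_cvg {R : realType} (q : R) m : q != 0 -> `|q| < 1 ->
  (fun n => pochn q q m * qbinom q n m) @ \oo --> (1 : R).
Proof.
move=> q0 q1; rewrite -(cvg_shiftn m) -(mulfV (qpoch_neq0 q q q1 q1)).
rewrite (_ : [sequence _]_n = fun d => pochn q q (d + m) * (pochn q q d)^-1); last first.
  by apply/funext => d /=; rewrite addnC pochn_qbinom_div.
apply: cvgM; last exact: pochn_inv_cvg.
by have := pochn_cvg q q q1; rewrite -(cvg_shiftn m).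
Qed.

(** Uniformity in m as well as in n is what the domination in Tannery's theorem
    needs: the quotient (q; q)_n / (q; q)_(n-m) is controlled by the convergence
    of (q; q)_n and of its inverse alone. *)
Lemma qbinom_bounded {R : realType} (q : R) : q != 0 -> `|q| < 1 ->
  exists2 B, 0 < B & forall n m, `|pochn q q m * qbinom q n m| <= B.
Proof.
move=> q0 q1.
have [U U0 pU] := cvg_norm_bounded _ _ (pochn_cvg q q q1).
have [V V0 pV] := cvg_norm_bounded _ _ (pochn_inv_cvg q q q1 q1).
exists (U * V) => [|n m]; first exact: mulr_gt0.
have [mn|nm] := leqP m n; last by rewrite qbinom_small// mulr0 normr0 mulr_ge0 ?ltW.
by rewrite -(subnKC mn) pochn_qbinom_div// normrM ler_pM.
Qed.

(** The coefficients of Cauchy's series for 1/(z; q)_oo. *)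
Definition cauchy_coef {F : fieldType} (z q : F) (k : nat) : F :=
  q ^+ (k * k.-1) * z ^+ k / (pochn z q k * pochn q q k).

Lemma cauchy_coef_bounded {R : realType} (z q : R) : `|z| < 1 -> `|q| < 1 ->
  exists2 B, 0 < B & forall k, `|cauchy_coef z q k| <= B * `|z| ^+ k.
Proof.
move=> z1 q1.
have [U U0 pU] := cvg_norm_bounded _ _ (pochn_inv_cvg z q z1 q1).
have [V V0 pV] := cvg_norm_bounded _ _ (pochn_inv_cvg q q q1 q1).
exists (U * V) => [|k]; first exact: mulr_gt0.
rewrite /cauchy_coef invfM normrM mulrC normrM [X in _ * X]normrM [`|z ^+ k|]normrX.
rewrite ler_pM ?mulr_ge0 ?exprn_ge0//; first by rewrite ler_pM.
by rewrite ler_piMl ?exprn_ge0// normrX exprn_ile1// ltW.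
Qed.

(** The factor (q; q)_(3k+r) grows by three consecutive factors with k; one of
    them is the factor of the cubic coefficient, and the other two are those of
    (q^3; q^3)_k and (z; q^3)_k, in one order for r = 0 and in the other for
    r = 1. *)
Lemma cubic_coef_cauchy {R : realType} (q : R) r k : q != 0 -> `|q| < 1 ->
  (r <= 1)%N ->
  cubic_coef q r k
  = pochn q q (3 * k + r) / pochn q q r * cauchy_coef (q ^+ (2 + 2 * r)) (q ^+ 3) k.
Proof.
move=> q0 q1 r1.
have qX j : 1 - q ^+ j.+1 != 0.
  by rewrite subr_eq0 eq_sym exprS mulrX_neq1.
have pq j : pochn q q j != 0 by apply: pochn_neq0 => i; apply: mulrX_neq1.
have q3 : `|q ^+ 3| < 1 by rewrite normrX exprn_ilt1.
have z1 : `|q ^+ (2 + 2 * r)| < 1 by rewrite normrX exprn_ilt1.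
have pq3 j : pochn (q ^+ 3) (q ^+ 3) j != 0.
  by apply: pochn_neq0 => i; apply: mulrX_neq1.
have pz j : pochn (q ^+ (2 + 2 * r)) (q ^+ 3) j != 0.
  by apply: pochn_neq0 => i; apply: mulrX_neq1.
elim: k => [|k IHk].
  rewrite /cubic_coef big_nil /cauchy_coef muln0 add0n divff// !pochn0.
  by rewrite mul0n !expr0 !mulr1 invr1 !mul1r.
rewrite cubic_coefS IHk /cauchy_coef.
have -> : pochn q q (3 * k.+1 + r) = pochn q q (3 * k + r) *
    (1 - q ^+ (3 * k + r).+1) * ((1 - q ^+ (3 * k + r).+2) * (1 - q ^+ (3 * k + r).+3)).
  rewrite (_ : 3 * k.+1 + r = (3 * k + r).+3)%N; last by lia.
  by rewrite !pochnS -!exprS !mulrA.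
have -> : (1 - q ^+ (3 * k + r).+2) * (1 - q ^+ (3 * k + r).+3)
  = (1 - q ^+ 3 * (q ^+ 3) ^+ k) * (1 - q ^+ (2 + 2 * r) * (q ^+ 3) ^+ k).
  rewrite -!exprM -!exprD; case: r r1 {IHk z1 pz} => [|[|]]// _.
    by rewrite mulrC; congr ((1 - q ^+ _) * (1 - q ^+ _)); lia.
  by congr ((1 - q ^+ _) * (1 - q ^+ _)); lia.
have -> : (q ^+ 3) ^+ (k.+1 * k.+1.-1) * (q ^+ (2 + 2 * r)) ^+ k.+1
  = (q ^+ 3) ^+ (k * k.-1) * (q ^+ (2 + 2 * r)) ^+ k * q ^+ (2 * (3 * k + r) + 2).
  rewrite -!exprM -!exprD; congr (_ ^+ _); case: k {IHk} => [|k] /=; lia.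
have := pz k.+1; have := pq3 k.+1; rewrite !pochnS !mulf_eq0 !negb_or.
move=> /andP[a1 a2] /andP[a3 a4]; field.
by rewrite a1 a2 a3 a4 pq.
Qed.

(** The sum S_r(n) and the finite Cauchy sum have the same coefficients and
    differ by weights (q; q)_m [n, m]_q and (Q; Q)_k [n, k]_Q that both tend
    to 1, so Tannery's theorem applies to their difference. *)
Lemma cubic_sum_cvg {R : realType} (q : R) r : q != 0 -> `|q| < 1 -> (r <= 1)%N ->
  cubic_sum q r @ \oo -->
    (pochn q q r)^-1 * (qpoch (q ^+ (2 + 2 * r)) (q ^+ 3))^-1.
Proof.
move=> q0 q1 r1; set z := q ^+ (2 + 2 * r); set Q := q ^+ 3.
have Q1 : `|Q| < 1 by rewrite normrX exprn_ilt1.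
have Q0 : Q != 0 by rewrite expf_neq0.
have z1 : `|z| < 1 by rewrite normrX exprn_ilt1.
pose D n k := cauchy_coef z Q k *
  (pochn q q (3 * k + r) * qbinom q n (3 * k + r) - pochn Q Q k * qbinom Q n k).
have -> : cubic_sum q r = fun n =>
    (pochn q q r)^-1 * ((pochn z Q n)^-1 + \sum_(0 <= k < n.+1) D n k).
  apply/funext => n; rewrite -(finite_cauchy Q z); last by move=> j; apply: mulrX_neq1.
  rewrite -big_split/= mulr_sumr; apply: eq_bigr => k _.
  rewrite cubic_coef_cauchy// /D -/z -/Q mulrBr [cauchy_coef z Q k * (pochn Q Q k * _)]mulrA.
  have -> : cauchy_coef z Q k * pochn Q Q k = Q ^+ (k * k.-1) * z ^+ k / pochn z Q k.
    rewrite /cauchy_coef invfM mulrA mulfVK//.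
    by apply: pochn_neq0 => j; apply: mulrX_neq1.
  by ring.
apply: cvgMr; rewrite -[X in _ --> X]addr0; apply: cvgD; first exact: pochn_inv_cvg.
have [B B0 hB] := cauchy_coef_bounded z Q z1 Q1.
have [U U0 hU] := qbinom_bounded q q0 q1.
have [V V0 hV] := qbinom_bounded Q Q0 Q1.
apply: (@tannery0 _ _ (B * (U + V)) `|z|); first by rewrite normr_ge0.
  move=> n k; rewrite normrM mulrAC ler_pM// (le_trans (ler_normB _ _))// lerD//.
move=> k; rewrite -(mulr0 (cauchy_coef z Q k)) -(subrr (1 : R)).
by apply: cvgMr; apply: cvgB; apply: qbinom_cvg.
Qed.

Lemma qpoch_recl {R : realType} (x q : R) : `|q| < 1 ->
  qpoch x q = (1 - x) * qpoch (x * q) q.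
Proof.
move=> q1; have : pochn x q @ \oo --> (1 - x) * qpoch (x * q) q.
  rewrite -cvg_shiftS (_ : [sequence _]_n = fun n => (1 - x) * pochn (x * q) q n).
    by apply: cvgMr; apply: pochn_cvg.
  by apply/funext => n /=; rewrite pochnSl.
by move=> /cvg_lim <-.
Qed.

Lemma cubic_sum0_cvg {R : realType} (q : R) : q != 0 -> `|q| < 1 ->
  cubic_sum q 0 @ \oo --> (qpoch (q ^+ 2) (q ^+ 3))^-1.
Proof.
by move=> q0 q1; have := cubic_sum_cvg q 0 q0 q1 isT; rewrite pochn0 invr1 mul1r.
Qed.

Lemma cubic_sum1_cvg {R : realType} (q : R) : q != 0 -> `|q| < 1 ->
  cubic_sum q 1 @ \oo --> (qpoch q (q ^+ 3))^-1.
Proof.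
move=> q0 q1; have := cubic_sum_cvg q 1 q0 q1 isT.
rewrite pochnS pochn0 expr0 mulr1 mul1r -invfM.
rewrite (qpoch_recl q)//; last by rewrite normrX exprn_ilt1.
Qed.

(** * Continued fractions *)

Lemma cf_convergent_gt0 {R : realType} (b : nat -> int) n :
  (forall i, 0 < b i) -> 0 < cf_convergent R b n.
Proof.
elim: n b => [|n IHn] b b0 /=; first by rewrite ltr0z.
by rewrite addr_gt0 ?ltr0z// invr_gt0 IHn.
Qed.

(** The convergents are defined from the front while solutions of the
    recurrence grow at the back.  Every solution s is a linear function of its
    initial values; its ratio of coefficients is determined by the convergent,
    with a factor kappa that is common to all solutions and cancels in p / q.
    Peeling off the first partial quotient multiplies kappa by the convergent
    of the shifted fraction. *)
Lemma cf_convergent_linear {R : realType} (b : nat -> int) n :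
  (forall i, 0 < b i.+1) ->
  exists2 kappa : R, kappa != 0 & forall s : nat -> R,
    (forall k, s k.+2 = (b k.+1)%:~R * s k.+1 + s k) ->
    s n.+1 = kappa * (s 0%N * (cf_convergent R b n - (b 0%N)%:~R) + s 1%N).
Proof.
elim: n b => [|n IHn] b b0.
  by exists 1 => [|s _]; rewrite ?oner_neq0//= subrr mulr0 add0r mul1r.
have [//|k k0 ks] := IHn (fun i => b i.+1).
have x0 : cf_convergent R (fun i => b i.+1) n != 0.
  by rewrite gt_eqF// cf_convergent_gt0.
exists (k * cf_convergent R (fun i => b i.+1) n) => [|s sE]; first exact: mulf_neq0.
rewrite (ks (fun i => s i.+1))//= sE; field.
by rewrite x0.
Qed.

(** Indices are shifted by one: p 0 and q 0 are the conventional values 1 and 0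
    at -1. *)
Lemma cf_convergentE {R : realType} (b : nat -> int) (p q : nat -> R) n :
  (forall i, 0 < b i.+1) ->
  p 0%N = 1 -> p 1%N = (b 0%N)%:~R -> q 0%N = 0 -> q 1%N = 1 ->
  (forall k, p k.+2 = (b k.+1)%:~R * p k.+1 + p k) ->
  (forall k, q k.+2 = (b k.+1)%:~R * q k.+1 + q k) ->
  cf_convergent R b n = p n.+1 / q n.+1.
Proof.
move=> b0 p0 p1 q0 q1 pE qE; have [k k0 kE] := @cf_convergent_linear R b n b0.
rewrite (kE p pE) (kE q qE) p0 p1 q0 q1 mul0r add0r mul1r subrK mulr1.
by rewrite mulrC mulKf.
Qed.

(** The power of a, with exponent 1 + 2 + ... + (n-1), clears the denominators
    of the recurrence when q = 1/a or q = -1/a. *)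
Definition scaled_cubic_sum {R : pzRingType} (a q : R) (r n : nat) : R :=
  a ^+ 'C(n, 2) * cubic_sum q r n.

Lemma scaled_cubic_sum_rec {F : fieldType} (a q : F) r n :
  q != 0 -> (r <= 1)%N ->
  scaled_cubic_sum a q r n.+2
  = (a ^+ n.+1 + (a * q) ^+ n.+1) * scaled_cubic_sum a q r n.+1
    - (a * q) ^+ (2 * n).+1 * scaled_cubic_sum a q r n.
Proof.
move=> q0 r1; rewrite /scaled_cubic_sum cubic_sum_rec//.
rewrite (binS n.+1 1) (binS n 1) !bin1 !exprD !exprMn.
have -> : a ^+ (2 * n).+1 = a ^+ n.+1 * a ^+ n.
  by rewrite -exprD; congr (_ ^+ _); lia.
by ring.
Qed.

Lemma cf_blocks2S (f g : nat -> int) a0 n :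
  cf_blocks a0 [:: f; g] n.+1 = if odd n then g n./2.+1 else f n./2.+1.
Proof. by rewrite /cf_blocks/= modn2 divn2; case: (odd n). Qed.

Lemma cvg_even_odd {R : realType} (u : nat -> R) (l : R) :
  (fun k => u k.*2) @ \oo --> l -> (fun k => u k.*2.+1) @ \oo --> l ->
  u @ \oo --> l.
Proof.
move=> /cvgrPdist_lt ev /cvgrPdist_lt od; apply/cvgrPdist_lt => e e0.
have [M _ hM] := ev e e0; have [N _ hN] := od e e0.
exists (M + N).*2 => // n /= MNn.
have := odd_double_half n; case: (odd n) => <-; [apply: hN|apply: hM] => /=; lia.
Qed.

Lemma norm_lt1_of_intmul {R : realType} (a : int) (q e : R) :
  1 < a -> `|e| = 1 -> a%:~R * q = e -> q != 0 /\ `|q| < 1.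
Proof.
move=> a1 e1 aq; have a1R : (1 : R) < a%:~R by rewrite ltr1z.
have a0R : (0 : R) < a%:~R by apply: lt_trans a1R.
have nq : a%:~R * `|q| = 1 by rewrite -(gtr0_norm a0R) -normrM aq e1.
have -> : q != 0.
  by apply: contra_eqN nq => /eqP->; rewrite normr0 mulr0 eq_sym oner_neq0.
by split=> //; rewrite -(ltr_pM2l a0R) nq mulr1.
Qed.

(** With a q = -1 the recurrence of the scaled sums is exactly that of the
    numerators and denominators. *)
Lemma cubic_cf_alternating {R : realType} (a : int) (q : R) :
  1 < a -> a%:~R * q = - 1 ->
  is_regular_cf_value
    (cf_blocks 1 [:: (fun k : nat => a ^+ (2 * k - 1) - 1);
                     (fun k : nat => a ^+ (2 * k) + 1)])
    (qpoch q (q ^+ 3) / qpoch (q ^+ 2) (q ^+ 3)).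
Proof.
move=> a1 aq; set b := cf_blocks _ _.
have [|q0 q1] := norm_lt1_of_intmul a q (-1) a1 _ aq; first by rewrite normrN1.
have bE n : b n.+1 = a ^+ n.+1 + (-1) ^+ n.+1.
  rewrite /b cf_blocks2S [(-1) ^+ _]exprS -signr_odd mulN1r.
  have := odd_double_half n; case: (odd n) => /= nE.
    by rewrite expr1 opprK; congr (_ ^+ _ + 1); lia.
  by rewrite expr0; congr (_ ^+ _ - 1); lia.
have b0 n : 0 < b n.+1.
  rewrite bE -ltrBlDr sub0r; apply: (@le_lt_trans _ _ 1); last by rewrite exprn_egt1.
  by apply: le_trans (ler_norm _) _; rewrite normrN normrX normrN1 expr1n.
split=> //.
pose X r n : R := scaled_cubic_sum a%:~R q r n.
have XE r k : (r <= 1)%N -> X r k.+2 = (b k.+1)%:~R * X r k.+1 + X r k.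
  move=> r1; rewrite /X scaled_cubic_sum_rec// aq bE rmorphD !rmorphXn/= rmorphN1.
  by rewrite [(-1) ^+ (2 * k).+1]exprS exprM sqrrN !expr1n mulr1 mulN1r opprK.
have -> : cf_convergent R b = fun n => cubic_sum q 0 n.+1 / cubic_sum q 1 n.+1.
  apply/funext => n; rewrite (cf_convergentE b (X 0%N) (X 1%N))//.
  - rewrite /X /scaled_cubic_sum -mulf_div divff ?mul1r//.
    by rewrite expf_neq0// intr_eq0 gt_eqF// (lt_trans _ a1).
  - by rewrite /X /scaled_cubic_sum cubic_sum_at0 mulr1.
  - by rewrite /X /scaled_cubic_sum cubic_sum_at1// mulr1.
  - by rewrite /X /scaled_cubic_sum cubic_sum_at0 mulr0.
  - by rewrite /X /scaled_cubic_sum cubic_sum_at1// mulr1.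
  - by move=> k; apply: XE.
  - by move=> k; apply: XE.
rewrite -[qpoch q _]invrK mulrC.
have q31 : `|q ^+ 3| < 1 by rewrite normrX exprn_ilt1.
apply: cvgM; first by have := cubic_sum0_cvg q q0 q1; rewrite -cvg_shiftS.
apply: cvgV; first by rewrite invr_eq0 qpoch_neq0.
by have := cubic_sum1_cvg q q0 q1; rewrite -cvg_shiftS.
Qed.

(** Eliminating the partial quotients 1 from the recurrence of the numerators
    p_n leaves p_(2k+2) = (a^(k+1) + 1) p_(2k) - p_(2k-2), the recurrence of the
    scaled sums for a q = 1.  The numerators of odd index are differences of
    neighbours of even index, and the term with the smaller power of a is
    negligible in the limit. *)
Lemma cubic_cf_unit {R : realType} (a : int) (q : R) :
  1 < a -> a%:~R * q = 1 ->
  is_regular_cf_value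
    (cf_blocks 1 [:: (fun k : nat => a ^+ k - 1); (fun k : nat => 1)])
    (qpoch (q ^+ 2) (q ^+ 3) / qpoch q (q ^+ 3)).
Proof.
move=> a1 aq; set b := cf_blocks _ _.
have [|q0 q1] := norm_lt1_of_intmul a q 1 a1 _ aq; first by rewrite normr1.
have bE n : b n.+1 = if odd n then 1 else a ^+ n./2.+1 - 1 by rewrite /b cf_blocks2S.
have b0 n : 0 < b n.+1.
  by rewrite bE; case: (odd n) => //; rewrite subr_gt0 exprn_egt1.
split=> //.
pose X r n : R := scaled_cubic_sum a%:~R q r n.
have XE r k : (r <= 1)%N -> X r k.+2 = (a%:~R ^+ k.+1 + 1) * X r k.+1 - X r k.
  by move=> r1; rewrite /X scaled_cubic_sum_rec// aq !expr1n mul1r.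
(* Y 1 and Y 0 are the numerators and denominators; Y at n is indexed so that
   Y at 0 belongs to the conventional index -1. *)
pose Y r n : R := if odd n then X r n./2.+1 else X r n./2.+1 - X r n./2.
have YE r k : (r <= 1)%N -> Y r k.+2 = (b k.+1)%:~R * Y r k.+1 + Y r k.
  move=> r1; rewrite /Y bE/= negbK uphalf_half; case: (odd k) => /=.
    by rewrite add1n; ring.
  by rewrite add0n XE// rmorphB rmorphXn/=; ring.
have X0 r : X r 0%N = (r == 0%N)%:R by rewrite /X /scaled_cubic_sum cubic_sum_at0 mul1r.
have X1 r : (r <= 1)%N -> X r 1%N = 1.
  by move=> r1; rewrite /X /scaled_cubic_sum cubic_sum_at1// mulr1.
have cE n : cf_convergent R b n = Y 1%N n.+1 / Y 0%N n.+1.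
  apply: (cf_convergentE b (Y 1%N) (Y 0%N)) => //.
  - by rewrite /Y/= X1// X0 subr0.
  - by rewrite /Y/= X1.
  - by rewrite /Y/= X1// X0 subrr.
  - by rewrite /Y/= X1.
  - by move=> k; apply: YE.
  - by move=> k; apply: YE.
have aX0 k : (a%:~R : R) ^+ k != 0.
  by rewrite expf_neq0// intr_eq0 gt_eqF// (lt_trans _ a1).
have q31 : `|q ^+ 3| < 1 by rewrite normrX exprn_ilt1.
have q21 : `|q ^+ 2| < 1 by rewrite normrX exprn_ilt1.
have S0 := cubic_sum0_cvg q q0 q1; have S1 := cubic_sum1_cvg q q0 q1.
rewrite -[qpoch (q ^+ 2) _]invrK mulrC.
apply: cvg_even_odd.
  rewrite (_ : (fun k => _) = fun k => cubic_sum q 1 k.+1 / cubic_sum q 0 k.+1).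
    apply: cvgM; first by rewrite (cvg_shiftS (cubic_sum q 1)).
    apply: cvgV; first by rewrite invr_eq0 qpoch_neq0.
    by rewrite (cvg_shiftS (cubic_sum q 0)).
  apply/funext => k; rewrite cE /Y/= odd_double uphalf_double/=.
  by rewrite /X /scaled_cubic_sum -mulf_div divff ?mul1r.
(* Dividing the difference of scaled sums by its common power of a. *)
pose Z r k : R := cubic_sum q r k.+2 - q ^+ k.+1 * cubic_sum q r k.+1.
rewrite (_ : (fun k => _) = fun k => Z 1%N k / Z 0%N k).
  have ZE r (l : R) : cubic_sum q r @ \oo --> l -> Z r @ \oo --> l.
    move=> Sl; rewrite -[l]subr0; apply: cvgB.
      by rewrite (cvg_shiftS (fun k => cubic_sum q r k.+1)) (cvg_shiftS (cubic_sum q r)).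
    rewrite -(mul0r l); apply: cvgM; last by rewrite (cvg_shiftS (cubic_sum q r)).
    by rewrite (cvg_shiftS (fun k => q ^+ k)); apply: cvg_expr.
  apply: cvgM; first exact: ZE.
  by apply: cvgV; [rewrite invr_eq0 qpoch_neq0|exact: ZE].
apply/funext => k; rewrite cE /Y/= odd_double/= doubleK.
have XZ r : X r k.+2 - X r k.+1 = a%:~R ^+ 'C(k.+2, 2) * Z r k.
  rewrite /X /Z /scaled_cubic_sum mulrBr; congr (_ - _).
  rewrite (binS k.+1 1) bin1 exprD mulrA -[_ * _ * q ^+ _]mulrA -exprMn aq.
  by rewrite expr1n mulr1.
by rewrite !XZ -mulf_div divff ?mul1r.
Qed.

Theorem theorem5 (R : realType) (a : int) (ha : 1 < a) :
  is_regular_cf_value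
    (cf_blocks 1 [:: (fun k : nat => a ^+ (2 * k - 1) - 1);
                     (fun k : nat => a ^+ (2 * k) + 1)])
    (qpoch (- 1 / a%:~R) (- 1 / a%:~R ^+ 3)
       / qpoch (1 / a%:~R ^+ 2) (- 1 / a%:~R ^+ 3) : R)
  /\
  is_regular_cf_value
    (cf_blocks 1 [:: (fun k : nat => a ^+ k - 1); (fun k : nat => 1)])
    (qpoch (1 / a%:~R ^+ 2) (1 / a%:~R ^+ 3)
       / qpoch (1 / a%:~R) (1 / a%:~R ^+ 3) : R).
Proof.
have a0 : a%:~R != 0 :> R by rewrite intr_eq0 gt_eqF// (lt_trans _ ha).
split.
  have <- : (- 1 / a%:~R) ^+ 3 = - 1 / a%:~R ^+ 3 :> R by field.
  have <- : (- 1 / a%:~R) ^+ 2 = 1 / a%:~R ^+ 2 :> R by field.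
  by apply: cubic_cf_alternating => //; field.
have <- : (1 / a%:~R) ^+ 3 = 1 / a%:~R ^+ 3 :> R by field.
have <- : (1 / a%:~R) ^+ 2 = 1 / a%:~R ^+ 2 :> R by field.
by apply: cubic_cf_unit => //; field.
Qed.
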